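(* Let $k$ be an algebraically closed field of characteristic $p=2$, and let $X$, $f:X\to A$, $\tau:A'\to A$, $X'=A'\times\mathbb{P}^1$, $\mathcal{F}$, $T_1$ and the fixed basis $\alpha,\beta$ of the Lie algebra of $\ker(\tau)$ be as described in the context, so that $X\cong X'/\mathcal{F}$, $\mathcal{F}\sim h^*\mathcal{O}_{\mathbb{P}^1}(-1)$, and over $A'\times\mathbb{A}^1_{(t)}$ the foliation $\mathcal{F}$ is generated by $$\delta=a(t)\alpha+b(t)\beta+c(t)\partial_t,\qquad a,b,c\in k[t],$$ which is unique up to multiplication by a nonzero scalar of $k$. Then (up to this rescaling) $\delta$ is given by one of the following forms, according to the type (I)–(IV) of $(\alpha,\beta)$. (I) [$\alpha^2=\beta^2=0$] $c=0$, and one of the polynomials $a,b$ is constant while the other has degree $1$. (II) [$\alpha^2=\alpha$, $\beta^2=\beta$] $ab\mid c$ with $0\le\min\{\deg a,\deg b\}\le\max\{\deg a,\deg b\}=1$. More precisely, there are mutually different $t_0,t_1,t_2\in k$ such that one of the following holds: (II-i) $a=1$, $b=\frac{t-t_1}{t_1+t_2}$, $c=\frac{(t-t_1)(t-t_2)}{t_1+t_2}$; (II-ii) $a=\frac{t-t_2}{t_1+t_2}$, $b=1$, $c=\frac{(t-t_1)(t-t_2)}{t_1+t_2}$; (II-iii) $a=t-t_2$, $b=t-t_1$, $c=(t-t_1)(t-t_2)$; (II-iv) $a=(t_0+t_1)(t-t_2)$, $b=(t_0+t_2)(t-t_1)$, $c=(t-t_0)(t-t_1)(t-t_2)$. (III)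 [$\alpha^2=\alpha$, $\beta^2=0$] $a^2b\mid c$. More precisely, there are two different elements $t_1,t_2\in k$ and a nonzero $s\in k$ such that one of the following holds: (III-i) $a=s(t-t_1)$, $b=1$, $c=s(t-t_1)^2$; (III-ii) $a=1$, $b=\frac{t-t_1}{s}$, $c=t-t_1$; (III-iii) $a=(t_1+t_2)(t-t_2)$, $b=\frac{t-t_1}{s}$, $c=(t-t_1)(t-t_2)^2$. (IV) [$\alpha^2=\beta$, $\beta^2=0$] $a^3\mid c$. More precisely, there are $t_1,t_2\in k$ and nonzero $s_1,s_2,r_2\in k$ such that one of the following holds: (IV-i) $a=1$, $b=\frac{t}{s_1}+t_2$, $c=s_1$; (IV-ii) $a=t$, $b=\frac{1}{s_1}+t_2t$, $c=s_1t^3$; (IV-iii) $a=t+s_1r_2$, $b=\frac{1}{s_1s_2}$, $c=s_1s_2(t+s_1r_2)^3$; (IV-iv) $t_1\neq t_2$ and $a=t-t_1$, $b=\frac{t-t_2}{s_1s_2(t_1+t_2)}$, $c=s_1s_2(t-t_1)^3$.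
   Context: Setting. $X$ is a smooth projective variety over an algebraically closed field $k$ of characteristic $p>0$ such that: resolution of singularities holds in dimension $<\dim X$; $-K_X$ is nef; the Albanese morphism $f=a_X:X\to A$ is of relative dimension one (it is then known to be a fibration); $f$ is inseparable (i.e. $K(X)/K(A)$ is not separable) and its generic fibre has arithmetic genus $0$. This forces $p=2$. A foliation on a smooth variety $Y$ is a saturated subsheaf $\mathcal{F}\subseteq\mathcal{T}_Y$ of the tangent bundle that is $p$-closed and involutive; $Y/\mathcal{F}=\mathrm{Spec}\{g\in\mathcal{O}_Y:\partial(g)=0\ \forall \partial\in\mathcal{F}\}$; it is smooth if $\mathcal{F}$ and $\mathcal{T}_Y/\mathcal{F}$ are locally free. In this setting it is known that there is a purely inseparable isogeny $\tau:A'\to A$ of abelian varieties of degree $p^2=4$ such that $X\times_AA'$ is not reduced, the normalization of $(X\times_AA')_{\mathrm{red}}$ is $X'=A'\times\mathbb{P}^1$, and $X\cong X'/\mathcal{F}$ for a smooth rank one foliation $\mathcal{F}$ on $X'$ with $\mathcal{F}\sim h^*\mathcal{O}_{\mathbb{P}^1}(-1)$, where $f':X'\to A'$ and $h:X'\to\mathbb{P}^1$ are the projections; with $\pi:X'\to X$ the quotient map, $f\circ\pi=\tau\circ f'$. The kernel of $\tau$ is an infinitesimal group scheme of length $p^2$, whose Lie algebra is spanned by $\alpha,\beta\in\ker\big(H^0(A',T_{A'})\to H^0(A',\tau^*T_A)\big)$ with $[\alpha,\beta]=0$ and $\alpha^2,\beta^2\in\mathrm{Span}_k\{\alpha,\beta\}$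 (squares are $p$-th powers of derivations). The basis $\alpha,\beta$ is chosen, once and for all, so that one of the following holds: (I) $\alpha^2=\beta^2=0$; (II) $\alpha^2=\alpha$, $\beta^2=\beta$; (III) $\alpha^2=\alpha$, $\beta^2=0$; (IV) $\alpha^2=\beta$, $\beta^2=0$. Via $T_{X'}\cong f'^*T_{A'}\oplus h^*T_{\mathbb{P}^1}$ regard $\alpha,\beta$ as vector fields on $X'$, and put $T_1=\mathcal{O}_{X'}\alpha\oplus\mathcal{O}_{X'}\beta\oplus h^*T_{\mathbb{P}^1}\subseteq T_{X'}$. Then $\mathcal{F}\subset T_1$. Let $t$ be the coordinate on $\mathbb{P}^1\setminus\{\infty\}=\mathbb{A}^1_{(t)}$. The inclusion $\mathcal{F}\cong h^*\mathcal{O}_{\mathbb{P}^1}(-1)\subset T_1$ is given by a nonzero section of $T_1\otimes h^*\mathcal{O}_{\mathbb{P}^1}(1)$, unique up to scaling, whose restriction to $A'\times\mathbb{A}^1_{(t)}$ is $\delta=a(t)\alpha+b(t)\beta+c(t)\partial_t$ with $a,b,c\in k[t]$ satisfying: (C1) $\gcd(a,b,c)=1$; (C2) $\deg a\le1$, $\deg b\le1$, $\deg c\le3$, with at least one equality; (C3) $\delta^2\in k[t]\cdot\delta$ ($p$-closedness).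
   Formalization: Case (I) fails for a fixed basis: tα+β in the basis α'=α+β, β is tα'+(t+1)β. The formal (I) gives c=0 and either the stated form, or deg a=deg b=1 and the stated form after replacing α by α+sβ for some s≠0. *)

(* Defs.v *)
From HB Require Import structures.
From mathcomp Require Import all_boot all_order all_algebra.

Set Implicit Arguments.
Unset Strict Implicit.
Unset Printing Implicit Defensive.

Import GRing.Theory.
Local Open Scope ring_scope.

(* Vector fields on the abelian variety A' are represented by k-derivations   *)
(* of its function field L = K(A'), where iota : k -> L is the inclusion of   *)
(* the constants; T_{A'} embeds in the constant sheaf Der_k(L).               *)
Record is_derivation (k L : fieldType) (iota : {rmorphism k -> L})
    (D : L -> L) : Prop := IsDerivation {
  derivationD : forall x y, D (x + y) = D x + D y;
  derivationM : forall x y, D (x * y) = D x * y + x * D y;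
  derivation_const : forall s, D (iota s) = 0
}.

Record lie_basis (k L : fieldType) (iota : {rmorphism k -> L})
    (alpha beta : L -> L) : Prop := LieBasis {
  lie_basis_derl : is_derivation iota alpha;
  lie_basis_derr : is_derivation iota beta;
  lie_basis_free : forall r s : k,
    (forall x, iota r * alpha x + iota s * beta x = 0) -> r = 0 /\ s = 0;
  lie_basis_comm : forall x, alpha (beta x) = beta (alpha x)
}.

Inductive lie_type := TypeI | TypeII | TypeIII | TypeIV.

(* In characteristic 2 the p-th power of a derivation is its composite with   *)
(* itself.                                                                    *)
Definition has_type (L : fieldType) (ty : lie_type) (alpha beta : L -> L) :
    Prop :=
  match ty with
  | TypeI => (forall x, alpha (alpha x) = 0) /\ (forall x, beta (beta x) = 0)
  | TypeII =>
      (forall x, alpha (alpha x) = alpha x) /\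
      (forall x, beta (beta x) = beta x)
  | TypeIII =>
      (forall x, alpha (alpha x) = alpha x) /\ (forall x, beta (beta x) = 0)
  | TypeIV =>
      (forall x, alpha (alpha x) = beta x) /\ (forall x, beta (beta x) = 0)
  end.

(* The vector field a(t) alpha + b(t) beta + c(t) d/dt on A' x A^1, acting on *)
(* L[t]; alpha and beta act on the coefficients, i.e. they kill t.            *)
Definition vfield (k L : fieldType) (iota : {rmorphism k -> L})
    (alpha beta : L -> L) (a b c : {poly k}) (F : {poly L}) : {poly L} :=
  map_poly iota a * map_poly alpha F + map_poly iota b * map_poly beta F
  + map_poly iota c * F^`().

(* The degree bounds say that the vector field extends to a global section of *)
(* T_1 (1) over A' x P^1, and the equality that it does not vanish along      *)
(* t = infinity. Recall that size p = deg p + 1 for p != 0, and size 0 = 0.   *)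
Record is_generator (k L : fieldType) (iota : {rmorphism k -> L})
    (alpha beta : L -> L) (a b c : {poly k}) : Prop := IsGenerator {
  generator_coprime : gcdp a (gcdp b c) %= 1;
  generator_size :
    [/\ (size a <= 2)%N, (size b <= 2)%N & (size c <= 4)%N];
  generator_size_eq : [\/ size a = 2, size b = 2 | size c = 4];
  generator_pclosed : exists g : {poly k}, forall F : {poly L},
    let delta := vfield iota alpha beta a b c in
    delta (delta F) = map_poly iota g * delta F
}.

Definition const_and_linear (k : fieldType) (a b : {poly k}) : Prop :=
  ((size a <= 1)%N /\ size b = 2) \/ (size a = 2 /\ (size b <= 1)%N).

(* A basis of type I is only determined up to GL_2(k), and the coefficients   *)
(* of the generator may both be linear: for t alpha + (t + 1) beta, no        *)
(* coefficient is constant until alpha is replaced by alpha + beta. The       *)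
(* second alternative is exactly this case.                                   *)
Definition form_I (k L : fieldType) (iota : {rmorphism k -> L})
    (alpha beta : L -> L) (a b c : {poly k}) : Prop :=
  c = 0 /\
  (const_and_linear a b \/
   [/\ size a = 2, size b = 2 & exists2 s : k, s != 0 &
     let alpha' x := alpha x + iota s * beta x in
     let b' := b - s *: a in
     [/\ lie_basis iota alpha' beta, has_type TypeI alpha' beta,
         vfield iota alpha beta a b c =1 vfield iota alpha' beta a b' c
       & const_and_linear a b']]).

Definition form_II (k : fieldType) (a b c : {poly k}) : Prop :=
  [/\ a * b %| c,
      (1 <= minn (size a) (size b))%N, maxn (size a) (size b) = 2
    & exists t0 t1 t2 : k,
      [/\ t0 != t1, t0 != t2, t1 != t2 &
      [\/ [/\ a = 1,
              b = (t1 + t2)^-1 *: ('X - t1%:P)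
            & c = (t1 + t2)^-1 *: (('X - t1%:P) * ('X - t2%:P))],
          [/\ a = (t1 + t2)^-1 *: ('X - t2%:P),
              b = 1
            & c = (t1 + t2)^-1 *: (('X - t1%:P) * ('X - t2%:P))],
          [/\ a = 'X - t2%:P,
              b = 'X - t1%:P
            & c = ('X - t1%:P) * ('X - t2%:P)]
        | [/\ a = (t0 + t1) *: ('X - t2%:P),
              b = (t0 + t2) *: ('X - t1%:P)
            & c = ('X - t0%:P) * ('X - t1%:P) * ('X - t2%:P)]]]].

Definition form_III (k : fieldType) (a b c : {poly k}) : Prop :=
  a ^+ 2 * b %| c /\
  exists t1 t2 s : k,
    [/\ t1 != t2, s != 0 &
    [\/ [/\ a = s *: ('X - t1%:P),
            b = 1
          & c = s *: ('X - t1%:P) ^+ 2],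
        [/\ a = 1,
            b = s^-1 *: ('X - t1%:P)
          & c = 'X - t1%:P]
      | [/\ a = (t1 + t2) *: ('X - t2%:P),
            b = s^-1 *: ('X - t1%:P)
          & c = ('X - t1%:P) * ('X - t2%:P) ^+ 2]]].

Definition form_IV (k : fieldType) (a b c : {poly k}) : Prop :=
  a ^+ 3 %| c /\
  exists t1 t2 s1 s2 r2 : k,
    [/\ s1 != 0, s2 != 0, r2 != 0 &
    [\/ [/\ a = 1,
            b = s1^-1 *: 'X + t2%:P
          & c = s1%:P],
        [/\ a = 'X,
            b = (s1^-1)%:P + t2 *: 'X
          & c = s1 *: 'X^3],
        [/\ a = 'X + (s1 * r2)%:P,
            b = ((s1 * s2)^-1)%:P
          & c = (s1 * s2) *: ('X + (s1 * r2)%:P) ^+ 3]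
      | [/\ t1 != t2,
            a = 'X - t1%:P,
            b = (s1 * s2 * (t1 + t2))^-1 *: ('X - t2%:P)
          & c = (s1 * s2) *: ('X - t1%:P) ^+ 3]]].

Definition normal_form (k L : fieldType) (iota : {rmorphism k -> L})
    (alpha beta : L -> L) (ty : lie_type) (a b c : {poly k}) : Prop :=
  match ty with
  | TypeI => form_I iota alpha beta a b c
  | TypeII => form_II a b c
  | TypeIII => form_III a b c
  | TypeIV => form_IV a b c
  end.

(* Main.v *)
Require Import Defs.
From HB Require Import structures.
From mathcomp Require Import all_boot all_order all_algebra.
From mathcomp Require Import ring.

Set Implicit Arguments.
Unset Strict Implicit.
Unset Printing Implicit Defensive.

Import GRing.Theory.
Local Open Scope ring_scope.

(* As 2 = 0 and alpha, beta, d/dt commute, the mixed terms of delta^2 cancel: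
   if alpha^2 = e11 alpha + e12 beta and beta^2 = e21 alpha + e22 beta, then
   delta^2 = (e11 a^2 + e21 b^2 + c a') alpha + (e12 a^2 + e22 b^2 + c b') beta
             + c c' d/dt.
   If delta^2 = g delta and c <> 0, the last coefficient forces g = c', and the
   other two become (a c)' = e11 a^2 + e21 b^2 and (b c)' = e12 a^2 + e22 b^2.
   In characteristic 2 a derivative only has terms of even degree, so comparing
   degrees 0 and 2 gives four equations between the coefficients of a, b, c.
   A root of a linear a or b allows one to solve them for the coefficients of c,
   and the degenerate cases are excluded because a, b, c have no common root
   and do not all drop degree. *)

(** * Sign-free arithmetic in characteristic 2 *)

Lemma addr0_eq_pchar2 (R : pzRingType) (x y : R) :
  2%:R = 0 :> R -> x + y = 0 -> x = y.
Proof.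
by move=> h2 /(canRL (addrK y)) ->; rewrite add0r -[- y]mulN1r
  -[LHS]addr0 -(mulr0 y) -h2 mulr_natr mulN1r mulr2n addKr.
Qed.

Lemma natr46_pchar2 (R : pzRingType) :
  2%:R = 0 :> R -> 4%:R = 0 :> R /\ 6%:R = 0 :> R.
Proof.
by move=> h2; rewrite -[4%N]/(2 * 2)%N -[6%N]/(2 * 3)%N !natrM h2 !mul0r.
Qed.

(* [ring] cancels against [2 = 0] only the monomials whose coefficient is
   exactly 2; adding up both sides makes all coefficients even, and the
   hypotheses [4 = 0] and [6 = 0] then remove the remaining ones. *)
Ltac char2_with h2 tac :=
  let h4 := fresh "h4" in let h6 := fresh "h6" in
  apply: (addr0_eq_pchar2 h2);
  have [h4 h6] := natr46_pchar2 h2;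
  tac h4 h6.
Ltac char2_ring h2 := char2_with h2 ltac:(fun h4 h6 => ring: h2 h4 h6).
Ltac char2_field h2 := char2_with h2 ltac:(fun h4 h6 => field: h2 h4 h6).

(** * From p-closedness of the vector field to identities in [k[t]] *)

Section VectorField.
Variables (k L : fieldType) (iota : {rmorphism k -> L}).
Hypothesis hk : 2%N \in [pchar k].

Local Notation lift p := (map_poly iota p).

Lemma derivation0 (D : L -> L) : is_derivation iota D -> D 0 = 0.
Proof. by move=> hD; have := derivation_const hD 0; rewrite rmorph0. Qed.

Lemma map_derivationD (D : L -> L) : is_derivation iota D ->
  forall F G : {poly L}, map_poly D (F + G) = map_poly D F + map_poly D G.
Proof.
move=> hD F G; have D0 := derivation0 hD.
by apply/polyP=> i; rewrite !(coefD, coef_map_id0) // (derivationD hD).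
Qed.

Lemma map_derivation_lift (D : L -> L) : is_derivation iota D ->
  forall p : {poly k}, map_poly D (lift p) = 0.
Proof.
move=> hD p; have D0 := derivation0 hD.
apply/polyP=> i.
by rewrite coef_map_id0 // coef_map coef0 (derivation_const hD).
Qed.

Lemma map_derivation_liftMC (D : L -> L) : is_derivation iota D ->
  forall (p : {poly k}) (x : L),
    map_poly D (lift p * x%:P) = lift p * (D x)%:P.
Proof.
move=> hD p x; have D0 := derivation0 hD.
apply/polyP=> i; rewrite coef_map_id0 // !coefMC !coef_map.
by rewrite (derivationM hD) (derivation_const hD) mul0r add0r.
Qed.

Lemma map_derivationC (D : L -> L) : is_derivation iota D ->
  forall x : L, map_poly D x%:P = (D x)%:P.
Proof.
move=> hD x; have := map_derivation_liftMC hD 1 x.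
by rewrite rmorph1 !mul1r.
Qed.

Variables (alpha beta : L -> L).
Hypothesis hbasis : lie_basis iota alpha beta.

(** Each power of [t] gives a [k]-linear relation between [alpha] and [beta], so freeness over [k]
    extends to [k[t]]. *)
Lemma lie_basis_poly_free (p q : {poly k}) :
  (forall x, lift p * (alpha x)%:P + lift q * (beta x)%:P = 0) ->
  p = 0 /\ q = 0.
Proof.
move=> pq0; have pq i : p`_i = 0 /\ q`_i = 0.
  apply: (lie_basis_free hbasis) => x.
  have /(congr1 (fun F : {poly L} => F`_i)) := pq0 x.
  by rewrite coefD !coefMC !coef_map coef0.
by split; apply/polyP=> i; rewrite coef0; case: (pq i).
Qed.

Variables (a b c : {poly k}).
Local Notation delta := (vfield iota alpha beta a b c).

Lemma vfieldC x : delta x%:P = lift a * (alpha x)%:P + lift b * (beta x)%:P.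
Proof.
have [hal hbe _ _] := hbasis.
by rewrite /vfield !map_derivationC // derivC mulr0 addr0.
Qed.

Lemma vfield_lift p : delta (lift p) = lift (c * p^`()).
Proof.
have [hal hbe _ _] := hbasis.
by rewrite /vfield !map_derivation_lift // !mulr0 !add0r rmorphM deriv_map.
Qed.

(** Testing [delta^2 = g delta] on the constants of [L[t]] isolates the [alpha] and [beta]
    components, since [d/dt] kills them; testing it on [t] isolates the [d/dt] component. *)
Lemma pclosed_relations (e11 e12 e21 e22 : k) :
    (forall x, alpha (alpha x) = iota e11 * alpha x + iota e12 * beta x) ->
    (forall x, beta (beta x) = iota e21 * alpha x + iota e22 * beta x) ->
    is_generator iota alpha beta a b c ->
  exists g : {poly k},
    [/\ e11 *: a ^+ 2 + e21 *: b ^+ 2 + c * a^`() = g * a,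
        e12 *: a ^+ 2 + e22 *: b ^+ 2 + c * b^`() = g * b
      & c * c^`() = g * c].
Proof.
move=> alpha2 beta2 [_ _ _ [g hg]]; exists g.
have [hal hbe _ comm] := hbasis.
have h2 : 2%:R = 0 :> {poly L}.
  by apply: pcharf0; rewrite pchar_poly; apply: rmorph_pchar hk.
have [] : e11 *: a ^+ 2 + e21 *: b ^+ 2 + c * a^`() - g * a = 0 /\
          e12 *: a ^+ 2 + e22 *: b ^+ 2 + c * b^`() - g * b = 0.
  apply: lie_basis_poly_free => x; rewrite !rmorphB !rmorphD /=.
  have /eqP := hg x%:P; rewrite /= -subr_eq0 vfieldC => /eqP <-.
  rewrite /vfield !map_derivationD // !map_derivation_liftMC //.
  rewrite derivD !derivM !derivC !mulr0 !addr0 alpha2 beta2 comm !deriv_map.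
  rewrite -!mul_polyC !rmorphM /= !map_polyC /= !polyCD !polyCM.
  ring: h2.
move=> /eqP; rewrite subr_eq0 => /eqP -> /eqP; rewrite subr_eq0 => /eqP ->.
split=> //; have := hg 'X.
rewrite /= -(map_polyX iota) !vfield_lift derivX mulr1 -rmorphM.
exact: map_inj_poly (fmorph_inj iota) (rmorph0 iota) _ _.
Qed.

End VectorField.

(** * Polynomials of degree at most 3 as lists of four coefficients *)

Section Relations.
Variables (k : closedFieldType).
Hypothesis hk : 2%N \in [pchar k].
Implicit Types (a b c g p q : {poly k}).

Let h2 : 2%:R = 0 :> k := pcharf0 hk.

Lemma addr_eq_pchar2 (x y z : k) : x + y = z -> y = z + x.
Proof. by move=> <-; char2_ring h2. Qed.

(** A uniform shape for [a], [b], [c] and the normal forms, so that an equality of polynomials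
    splits by [congr] into four identities in [k]. *)
Definition cubic (x0 x1 x2 x3 : k) : {poly k} := Poly [:: x0; x1; x2; x3].

Lemma coef_cubic x0 x1 x2 x3 i :
  (cubic x0 x1 x2 x3)`_i = [:: x0; x1; x2; x3]`_i.
Proof. exact: coef_Poly. Qed.

Lemma cubic_coefs p : (size p <= 4)%N -> p = cubic p`_0 p`_1 p`_2 p`_3.
Proof.
move=> sp; apply/polyP=> i; rewrite coef_cubic.
case: i => [|[|[|[|i]]]] //; rewrite [RHS]nth_default // nth_default //.
exact: leq_trans sp _.
Qed.

Lemma horner_cubic x0 x1 x2 x3 x :
  (cubic x0 x1 x2 x3).[x] = x0 + x1 * x + x2 * x ^+ 2 + x3 * x ^+ 3.
Proof. by rewrite horner_Poly /=; ring. Qed.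

Lemma cubicZ u x0 x1 x2 x3 :
  u *: cubic x0 x1 x2 x3 = cubic (u * x0) (u * x1) (u * x2) (u * x3).
Proof.
apply/polyP=> i; rewrite coefZ !coef_cubic.
by case: i => [|[|[|[|i]]]] //=; rewrite !nth_nil mulr0.
Qed.

Lemma cubicD x0 x1 x2 x3 y0 y1 y2 y3 :
  cubic x0 x1 x2 x3 + cubic y0 y1 y2 y3 =
  cubic (x0 + y0) (x1 + y1) (x2 + y2) (x3 + y3).
Proof.
apply/polyP=> i; rewrite coefD !coef_cubic.
by case: i => [|[|[|[|i]]]] //=; rewrite !nth_nil addr0.
Qed.

Lemma cubic_polyC x : x%:P = cubic x 0 0 0.
Proof.
by apply/polyP=> i; rewrite coef_cubic coefC;
  case: i => [|[|[|[|i]]]] //=; rewrite nth_nil.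
Qed.

Lemma cubic0 : cubic 0 0 0 0 = 0.
Proof. by rewrite -cubic_polyC. Qed.

Lemma cubic_polyX : 'X = cubic 0 1 0 0.
Proof.
by apply/polyP=> i; rewrite coef_cubic coefX;
  case: i => [|[|[|[|i]]]] //=; rewrite nth_nil.
Qed.

Lemma cubic_polyX3 : 'X^3 = cubic 0 0 0 1.
Proof.
by apply/polyP=> i; rewrite coef_cubic coefXn;
  case: i => [|[|[|[|i]]]] //=; rewrite nth_nil.
Qed.

Lemma cubic_XsubC x : 'X - x%:P = cubic x 1 0 0.
Proof.
by rewrite -polyCN oppr_pchar2 // cubic_polyC cubic_polyX cubicD !add0r addr0.
Qed.

Lemma cubicM12 x0 x1 x2 y0 y1 : cubic x0 x1 x2 0 * cubic y0 y1 0 0 =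
  cubic (x0 * y0) (x0 * y1 + x1 * y0) (x1 * y1 + x2 * y0) (x2 * y1).
Proof.
have E z0 z1 z2 z3 : cubic z0 z1 z2 z3 =
    z0%:P + z1%:P * 'X + z2%:P * 'X^2 + z3%:P * 'X^3.
  apply/polyP=> i; rewrite coef_cubic !coefD !coefCM !coefXn coefC coefX.
  by case: i => [|[|[|[|i]]]] /=; rewrite ?nth_nil; ring.
by rewrite !E; ring.
Qed.

(** [mulrA] associates to the left, so in every product of linear factors the right one is linear
    and [cubicM12] applies. *)
Definition cubicE := (expr0, exprS, mulr1, mulrA, addr0, cubic_XsubC,
  cubic_polyC, cubic_polyX, cubic_polyX3, cubicD, cubicM12, cubicZ).

(** * Comparing coefficients of degrees 0 and 2 *)

Lemma deriv_mul_coefs p q : (size p <= 2)%N ->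
  (p * q)^`()`_0 = p`_0 * q`_1 + p`_1 * q`_0 /\
  (p * q)^`()`_2 = p`_0 * q`_3 + p`_1 * q`_2.
Proof.
move=> sp; have p2 : p`_2 = 0 by rewrite nth_default.
have p3 : p`_3 = 0 by rewrite nth_default // ltnW.
(* The coefficient of [t^2] in the derivative is 3 times that of [t^3] in the product, and 3 = 1. *)
rewrite !coef_deriv !coefM !big_ord_recr !big_ord0 /= p2.
by rewrite p3 !(subSS, subn0); split; [ring | char2_ring h2].
Qed.

Lemma sqr_coefs p : (size p <= 2)%N ->
  (p ^+ 2)`_0 = p`_0 ^+ 2 /\ (p ^+ 2)`_2 = p`_1 ^+ 2.
Proof.
move=> sp; have p2 : p`_2 = 0 by rewrite nth_default.
rewrite expr2 !coefM !big_ord_recr !big_ord0 /= p2.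
by split; ring.
Qed.

(** Here [g = c'] turns the relation into [(p c)' = e p^2 + e' q^2]. It serves for [p = a], [q = b]
    and, with the roles exchanged, for [p = b], [q = a]. *)
Lemma relation_coefs (e e' : k) p q c g :
    (size p <= 2)%N -> (size q <= 2)%N -> c != 0 -> c * c^`() = g * c ->
    e *: p ^+ 2 + e' *: q ^+ 2 + c * p^`() = g * p ->
  p`_0 * c`_1 + p`_1 * c`_0 = e * p`_0 ^+ 2 + e' * q`_0 ^+ 2 /\
  p`_0 * c`_3 + p`_1 * c`_2 = e * p`_1 ^+ 2 + e' * q`_1 ^+ 2.
Proof.
move=> sp sq c0; rewrite mulrC => /(mulIf c0) <- rel.
have {}rel : (p * c)^`() = e *: p ^+ 2 + e' *: q ^+ 2.
  have h2P : 2%:R = 0 :> {poly k} by apply: pcharf0; rewrite pchar_poly.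
  by rewrite derivM [p * _]mulrC -rel; char2_ring h2P.
have [<- <-] := deriv_mul_coefs c sp.
rewrite rel !coefD !coefZ.
by have [-> ->] := sqr_coefs sp; have [-> ->] := sqr_coefs sq.
Qed.

(** A root of [(X - x)(X - y) + 1] avoids both points. It supplies a parameter that the form at hand
    leaves free but that must differ from the others. *)
Lemma exists_other2 (x y : k) : exists z, x != z /\ y != z.
Proof.
have /closed_rootP[z] : size (('X - x%:P) * ('X - y%:P) + 1) != 1.
  rewrite size_polyDl //.
    by rewrite size_mul ?polyXsubC_eq0 // !size_XsubC.
  by rewrite size_mul ?polyXsubC_eq0 // !size_XsubC size_poly1.
rewrite rootE !hornerE => z0; exists z.
by split; apply/eqP=> e; move: z0; rewrite e subrr ?mulr0 ?mul0r add0r oner_eq0.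
Qed.
Lemma gcdp3_no_root a b c x :
  gcdp a (gcdp b c) %= 1 -> root a x -> root b x -> root c x -> False.
Proof.
move=> /eqp_root/(_ x) + ra rb rc.
by rewrite (negPf (root1 x)) !root_gcd ra rb rc.
Qed.

Lemma size_coef_neq0 n p : size p = n.+1 -> p`_n != 0.
Proof.
by move=> sp; rewrite -[n]/(n.+1.-1) -sp -lead_coefE lead_coef_eq0
  -size_poly_gt0 sp.
Qed.

(** * Divisibility and degree conditions read off from the explicit forms *)

Lemma form_II_intro a b c t0 t1 t2 :
    t0 != t1 -> t0 != t2 -> t1 != t2 ->
    [\/ [/\ a = 1,
            b = (t1 + t2)^-1 *: ('X - t1%:P)
          & c = (t1 + t2)^-1 *: (('X - t1%:P) * ('X - t2%:P))],
        [/\ a = (t1 + t2)^-1 *: ('X - t2%:P),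
            b = 1
          & c = (t1 + t2)^-1 *: (('X - t1%:P) * ('X - t2%:P))],
        [/\ a = 'X - t2%:P,
            b = 'X - t1%:P
          & c = ('X - t1%:P) * ('X - t2%:P)]
      | [/\ a = (t0 + t1) *: ('X - t2%:P),
            b = (t0 + t2) *: ('X - t1%:P)
          & c = ('X - t0%:P) * ('X - t1%:P) * ('X - t2%:P)]] ->
  form_II a b c.
Proof.
have add_neq0 (x y : k) : x != y -> x + y != 0.
  by rewrite -{2}(oppr_pchar2 hk y) subr_eq0.
move=> n01 n02 n12 abc; split; last by exists t0, t1, t2; split.
- case: abc => -[-> -> ->].
  + by rewrite mul1r scalerAl dvdp_mulr.
  + by rewrite mulr1 mulrC scalerAl dvdp_mulr.
  + by rewrite mulrC.
  + rewrite -scalerAl -scalerAr !dvdpZl ?add_neq0 //.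
    by rewrite -mulrA [X in _ %| X]mulrC [('X - t1%:P) * _]mulrC dvdp_mulr.
- by case: abc => -[-> -> _];
    rewrite ?size_scale ?invr_eq0 ?add_neq0 ?size_XsubC ?size_poly1.
- by case: abc => -[-> -> _];
    rewrite ?size_scale ?invr_eq0 ?add_neq0 ?size_XsubC ?size_poly1.
Qed.

Lemma form_III_intro a b c t1 t2 s :
    t1 != t2 -> s != 0 ->
    [\/ [/\ a = s *: ('X - t1%:P), b = 1 & c = s *: ('X - t1%:P) ^+ 2],
        [/\ a = 1, b = s^-1 *: ('X - t1%:P) & c = 'X - t1%:P]
      | [/\ a = (t1 + t2) *: ('X - t2%:P),
            b = s^-1 *: ('X - t1%:P)
          & c = ('X - t1%:P) * ('X - t2%:P) ^+ 2]] ->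
  form_III a b c.
Proof.
move=> n12 sn abc; split; last by exists t1, t2, s; split.
have n12' : t1 + t2 != 0 by rewrite -{1}(oppr_pchar2 hk t2) subr_eq0.
case: abc => -[-> -> ->].
- by rewrite mulr1 exprZn dvdpZl ?expf_neq0 // dvdpZr.
- by rewrite expr1n mul1r dvdpZl ?invr_eq0.
- by rewrite exprZn -scalerAl -scalerAr !dvdpZl ?invr_eq0 ?expf_neq0 // mulrC.
Qed.

Lemma form_IV_intro a b c t1 t2 s1 s2 r2 :
    s1 != 0 -> s2 != 0 -> r2 != 0 ->
    [\/ [/\ a = 1, b = s1^-1 *: 'X + t2%:P & c = s1%:P],
        [/\ a = 'X, b = (s1^-1)%:P + t2 *: 'X & c = s1 *: 'X^3],
        [/\ a = 'X + (s1 * r2)%:P,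
            b = ((s1 * s2)^-1)%:P
          & c = (s1 * s2) *: ('X + (s1 * r2)%:P) ^+ 3]
      | [/\ t1 != t2,
            a = 'X - t1%:P,
            b = (s1 * s2 * (t1 + t2))^-1 *: ('X - t2%:P)
          & c = (s1 * s2) *: ('X - t1%:P) ^+ 3]] ->
  form_IV a b c.
Proof.
move=> s1n s2n r2n abc; split; last by exists t1, t2, s1, s2, r2; split.
case: abc => [[-> _ _]|[-> _ ->]|[-> _ ->]|[_ -> _ ->]].
- by rewrite expr1n dvd1p.
- by rewrite dvdpZr.
- by rewrite dvdpZr ?mulf_neq0.
- by rewrite dvdpZr ?mulf_neq0.
Qed.

(** Brings an equation with zero right-hand side into the shape [e * y] with [e = 0] that
    [linear_coefs] and [constant_coefs] expect. *)
Lemma eq0_mul0 (y x : k) : x = 0 -> x = 0 * y.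
Proof. by rewrite mul0r. Qed.

(** * Solving the coefficient equations, type by type *)

Section Coefficients.
Variables (a0 a1 b0 b1 c0 c1 c2 c3 : k).

Local Notation a := (cubic a0 a1 0 0).
Local Notation b := (cubic b0 b1 0 0).
Local Notation c := (cubic c0 c1 c2 c3).

Hypothesis no_root : forall x, a0 + a1 * x = 0 -> b0 + b1 * x = 0 ->
  c0 + c1 * x + c2 * x ^+ 2 + c3 * x ^+ 3 = 0 -> False.
Hypothesis ab_neq0 : ~ [/\ a0 = 0, a1 = 0, b0 = 0 & b1 = 0].
Hypothesis top_neq0 : ~ [/\ a1 = 0, b1 = 0 & c3 = 0].

(** As -1 = 1, this [r] is the root of [x0 + x1 t]. *)
Lemma linear_root (x0 x1 : k) : x1 != 0 -> exists r, x0 = x1 * r.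
Proof. by move=> x1n; exists (x0 / x1); field. Qed.

(** Substitute [x0 = x1 r] and divide by [x1]. The two formulas imply [c(r) = 0], so [no_root]
    applies as soon as the other linear polynomial also vanishes at [r]. *)
Lemma linear_coefs (e x0 x1 r : k) : x1 != 0 -> x0 = x1 * r ->
    x0 * c1 + x1 * c0 = e * x0 ^+ 2 -> x0 * c3 + x1 * c2 = e * x1 ^+ 2 ->
  c0 = r * c1 + e * x1 * r ^+ 2 /\ c2 = e * x1 + r * c3.
Proof.
move=> x1n -> /(addr_eq_pchar2) E1 /(addr_eq_pchar2) E2.
by split; apply: (mulfI x1n); [rewrite E1 | rewrite E2]; char2_ring h2.
Qed.

(** For a nonzero constant [p = x0], the equation [(p c)' = e p^2] says [c' = e p]. The vanishing of
    [c3] is what contradicts [top_neq0] when [a] and [b] are both constant. *)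
Lemma constant_coefs (e x0 x1 : k) : x1 = 0 -> x0 != 0 ->
    x0 * c1 + x1 * c0 = e * x0 ^+ 2 -> x0 * c3 + x1 * c2 = e * x1 ^+ 2 ->
  c1 = e * x0 /\ c3 = 0.
Proof.
move=> -> x0n; rewrite !mul0r !addr0 expr0n mulr0 => E1 E2.
by split; apply: (mulfI x0n); rewrite ?E1 ?E2; ring.
Qed.

Lemma relations_II :
    a0 * c1 + a1 * c0 = a0 ^+ 2 -> a0 * c3 + a1 * c2 = a1 ^+ 2 ->
    b0 * c1 + b1 * c0 = b0 ^+ 2 -> b0 * c3 + b1 * c2 = b1 ^+ 2 ->
  exists2 u : k, u != 0 & form_II (u *: a) (u *: b) (u *: c).
Proof.
have half (x0 x1 r : k) : x1 != 0 -> x0 = x1 * r ->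
    x0 * c1 + x1 * c0 = x0 ^+ 2 -> x0 * c3 + x1 * c2 = x1 ^+ 2 ->
    c0 = r * c1 + x1 * r ^+ 2 /\ c2 = x1 + r * c3.
  by have := @linear_coefs 1 x0 x1 r; rewrite !mul1r.
have const (x0 x1 : k) : x1 = 0 -> x0 != 0 ->
    x0 * c1 + x1 * c0 = x0 ^+ 2 -> x0 * c3 + x1 * c2 = x1 ^+ 2 ->
    c1 = x0 /\ c3 = 0.
  by have := @constant_coefs 1 x0 x1; rewrite !mul1r.
move=> A1 A2 B1 B2.
have [a1z | a1n] := eqVneq a1 0.
  have [b1z | b1n] := eqVneq b1 0.
    have [a0z | a0n] := eqVneq a0 0; last first.
      by case: top_neq0; have [_ ->] := const _ _ a1z a0n A1 A2.
    have [b0z | b0n] := eqVneq b0 0; first by case: ab_neq0.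
    by case: top_neq0; have [_ ->] := const _ _ b1z b0n B1 B2.
  have [r b0E] := linear_root b0 b1n.
  have [c0E c2E] := half _ _ _ b1n b0E B1 B2.
  have [a0z | a0n] := eqVneq a0 0.
    case: (no_root (x := r)); rewrite ?a0z ?a1z ?b0E ?c0E ?c2E; char2_ring h2.
  have [c1E c3E] := const _ _ a1z a0n A1 A2.
  (* Scaling to [a = 1] gives [b] the leading coefficient [b1 / a0], so with [t1 = r] the form
     forces [t1 + t2 = a0 / b1]. *)
  exists a0^-1; first by rewrite invr_eq0.
  have [t0 [t0r t0s]] := exists_other2 r (r + a0 / b1).
  have dE : r + (r + a0 / b1) = a0 / b1 by char2_ring h2.
  have dn : a0 / b1 != 0 by rewrite mulf_neq0 ?invr_eq0.
  apply: (@form_II_intro _ _ _ t0 r (r + a0 / b1)).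
  - by rewrite eq_sym.
  - by rewrite eq_sym.
  - by rewrite -subr_eq0 (oppr_pchar2 hk) dE.
  by apply: Or41; rewrite dE -polyC1 !cubicE; split; congr cubic;
    rewrite ?c0E ?c1E ?c2E ?c3E ?b0E ?a1z;
    char2_field h2; rewrite ?a0n ?b1n.
have [r a0E] := linear_root a0 a1n.
have [c0E c2E] := half _ _ _ a1n a0E A1 A2.
have [b1z | b1n] := eqVneq b1 0.
  have [b0z | b0n] := eqVneq b0 0.
    case: (no_root (x := r)); rewrite ?b0z ?b1z ?a0E ?c0E ?c2E; char2_ring h2.
  have [c1E c3E] := const _ _ b1z b0n B1 B2.
  exists b0^-1; first by rewrite invr_eq0.
  have [t0 [t0r t0s]] := exists_other2 r (r + b0 / a1).
  have dE : (r + b0 / a1) + r = b0 / a1 by char2_ring h2.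
  have dn : b0 / a1 != 0 by rewrite mulf_neq0 ?invr_eq0.
  apply: (@form_II_intro _ _ _ t0 (r + b0 / a1) r).
  - by rewrite eq_sym.
  - by rewrite eq_sym.
  - by rewrite -subr_eq0 (oppr_pchar2 hk) dE.
  by apply: Or42; rewrite dE -polyC1 !cubicE; split; congr cubic;
    rewrite ?c0E ?c1E ?c2E ?c3E ?a0E ?b1z;
    char2_field h2; rewrite ?b0n ?a1n.
have [s b0E] := linear_root b0 b1n.
have [c0E' c2E'] := half _ _ _ b1n b0E B1 B2.
(* From here on [r] is the root of [a] and [s] that of [b]. If they agreed, [c] would vanish there
   too. *)
have rs : s + r != 0.
  apply/eqP => /(addr_eq_pchar2); rewrite add0r => rs.
  case: (no_root (x := r)); rewrite ?b0E ?a0E ?rs ?c0E' ?c2E'; char2_ring h2.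
(* Equate the values of [c2] obtained from [a] and from [b]; the values of [c0] then give [c1]. *)
have abE : a1 + b1 = (s + r) * c3.
  transitivity ((a1 + r * c3) + (b1 + s * c3) + (s + r) * c3).
    by char2_ring h2.
  by rewrite -c2E -c2E'; char2_ring h2.
have c1E : c1 = (a1 * r ^+ 2 + b1 * s ^+ 2) / (s + r).
  apply: (mulIf rs); rewrite divfK //.
  transitivity ((s * c1 + b1 * s ^+ 2) + (r * c1 + a1 * r ^+ 2)
                + (a1 * r ^+ 2 + b1 * s ^+ 2)); first by char2_ring h2.
  by rewrite -c0E -c0E'; char2_ring h2.
(* The degree of [c] separates the last two forms: it is 2 in (II-iii) and 3 in (II-iv). *)
have [c3z | c3n] := eqVneq c3 0.
  have b1E : b1 = a1.
    by move: abE; rewrite c3z mulr0 => /addr_eq_pchar2 ->; rewrite add0r.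
  exists a1^-1; first by rewrite invr_eq0.
  have [t0 [t0r t0s]] := exists_other2 s r.
  apply: (@form_II_intro _ _ _ t0 s r).
  - by rewrite eq_sym.
  - by rewrite eq_sym.
  - by rewrite -subr_eq0 (oppr_pchar2 hk).
  by apply: Or43; rewrite !cubicE; split; congr cubic;
    rewrite ?c0E ?c1E ?c2E ?c3z ?a0E ?b0E ?b1E;
    char2_field h2; rewrite ?a1n ?rs.
exists c3^-1; first by rewrite invr_eq0.
have b1E : b1 = a1 + (s + r) * c3 by rewrite -abE; char2_ring h2.
(* The third root of [c]: the roots add up to [c2 / c3 = a1 / c3 + r]. Then [t0 + s = a1 / c3] and
   [t0 + r = b1 / c3] are the leading coefficients of the scaled [a] and [b]. *)
pose t0 := s + a1 / c3.
apply: (@form_II_intro _ _ _ t0 s r).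
- rewrite -subr_eq0 (oppr_pchar2 hk) addrAC addrr_pchar2 // add0r.
  by rewrite mulf_neq0 ?invr_eq0.
- rewrite -subr_eq0 (oppr_pchar2 hk).
  have -> : t0 + r = b1 / c3 by rewrite b1E /t0; char2_field h2.
  by rewrite mulf_neq0 ?invr_eq0.
- by rewrite -subr_eq0 (oppr_pchar2 hk).
by apply: Or44; rewrite /t0 !cubicE; split; congr cubic;
  rewrite ?c0E ?c1E ?c2E ?a0E ?b0E ?b1E;
  char2_field h2; rewrite ?c3n ?rs.
Qed.

Lemma relations_III :
    a0 * c1 + a1 * c0 = a0 ^+ 2 -> a0 * c3 + a1 * c2 = a1 ^+ 2 ->
    b0 * c1 + b1 * c0 = 0 -> b0 * c3 + b1 * c2 = 0 ->
  exists2 u : k, u != 0 & form_III (u *: a) (u *: b) (u *: c).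
Proof.
rewrite -[a0 ^+ 2]mul1r -[a1 ^+ 2]mul1r => A1 A2.
move=> /(eq0_mul0 (b0 ^+ 2)) B1 /(eq0_mul0 (b1 ^+ 2)) B2.
have [a1z | a1n] := eqVneq a1 0.
  have [b1z | b1n] := eqVneq b1 0.
    have [a0z | a0n] := eqVneq a0 0; last first.
      by case: top_neq0; have [_ ->] := constant_coefs a1z a0n A1 A2.
    have [b0z | b0n] := eqVneq b0 0; first by case: ab_neq0.
    by case: top_neq0; have [_ ->] := constant_coefs b1z b0n B1 B2.
  have [r b0E] := linear_root b0 b1n.
  have [c0E c2E] := linear_coefs b1n b0E B1 B2.
  have [a0z | a0n] := eqVneq a0 0.
    case: (no_root (x := r)); rewrite ?a0z ?a1z ?b0E ?c0E ?c2E; char2_ring h2.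
  have [c1E c3E] := constant_coefs a1z a0n A1 A2.
  exists a0^-1; first by rewrite invr_eq0.
  have [t2 [rt2 _]] := exists_other2 r r.
  have sn : a0 / b1 != 0 by rewrite mulf_neq0 ?invr_eq0.
  apply: (form_III_intro rt2 sn).
  by apply: Or32; rewrite -polyC1 !cubicE; split; congr cubic;
    rewrite ?c0E ?c1E ?c2E ?c3E ?b0E ?a1z; char2_field h2; rewrite ?a0n ?b1n.
have [r a0E] := linear_root a0 a1n.
have [c0E c2E] := linear_coefs a1n a0E A1 A2.
have [b1z | b1n] := eqVneq b1 0.
  have [b0z | b0n] := eqVneq b0 0.
    case: (no_root (x := r)); rewrite ?b0z ?b1z ?a0E ?c0E ?c2E; char2_ring h2.
  have [c1E c3E] := constant_coefs b1z b0n B1 B2.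
  exists b0^-1; first by rewrite invr_eq0.
  have [t2 [rt2 _]] := exists_other2 r r.
  have sn : a1 / b0 != 0 by rewrite mulf_neq0 ?invr_eq0.
  apply: (form_III_intro rt2 sn).
  by apply: Or31; rewrite -polyC1 !cubicE; split; congr cubic;
    rewrite ?c0E ?c1E ?c2E ?c3E ?a0E ?b1z; char2_field h2; rewrite ?b0n.
have [s b0E] := linear_root b0 b1n.
have [c0E' c2E'] := linear_coefs b1n b0E B1 B2.
have rs : s + r != 0.
  apply/eqP => /(addr_eq_pchar2); rewrite add0r => rs.
  case: (no_root (x := r)); rewrite ?b0E ?a0E ?rs ?c0E' ?c2E'; char2_ring h2.
(* Again two values of [c2] are compared, now with [e = 1] for [a] and [e = 0] for [b]. With [c1]
   found below, [c = c3 (t - s)(t - r)^2]. *)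
have a1E : a1 = (s + r) * c3.
  transitivity ((1 * a1 + r * c3) + (0 * b1 + s * c3) + (s + r) * c3).
    by char2_ring h2.
  by rewrite -c2E -c2E'; char2_ring h2.
have c3n : c3 != 0 by apply: contraNneq a1n => c3z; rewrite a1E c3z mulr0.
have c1E : c1 = c3 * r ^+ 2.
  apply: (mulIf rs).
  transitivity ((s * c1 + 0 * b1 * s ^+ 2) + (r * c1 + 1 * a1 * r ^+ 2)
                + (s + r) * c3 * r ^+ 2); first by rewrite a1E; char2_ring h2.
  by rewrite -c0E -c0E'; char2_ring h2.
exists c3^-1; first by rewrite invr_eq0.
have sr : s != r by rewrite -subr_eq0 (oppr_pchar2 hk).
(* The roots [s] and [r] become [t1] and [t2]; the scalar called [s] in the form is [c3 / b1]. *)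
have sn : c3 / b1 != 0 by rewrite mulf_neq0 ?invr_eq0.
apply: (form_III_intro sr sn).
by apply: Or33; rewrite !cubicE; split; congr cubic;
  rewrite ?c0E' ?c2E' ?c1E ?a0E ?a1E ?b0E; char2_field h2; rewrite ?c3n ?b1n.
Qed.

Lemma relations_IV :
    a0 * c1 + a1 * c0 = 0 -> a0 * c3 + a1 * c2 = 0 ->
    b0 * c1 + b1 * c0 = a0 ^+ 2 -> b0 * c3 + b1 * c2 = a1 ^+ 2 ->
  exists2 u : k, u != 0 & form_IV (u *: a) (u *: b) (u *: c).
Proof.
have [a1z | a1n] := eqVneq a1 0.
  have [a0z | a0n] := eqVneq a0 0.
    move=> _ _; rewrite a0z a1z expr0n /=.
    move=> /(eq0_mul0 (b0 ^+ 2)) B1 /(eq0_mul0 (b1 ^+ 2)) B2.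
    have [b1z | b1n] := eqVneq b1 0.
      have [b0z | b0n] := eqVneq b0 0; first by case: ab_neq0.
      by case: top_neq0; have [_ ->] := constant_coefs b1z b0n B1 B2.
    have [r b0E] := linear_root b0 b1n.
    have [c0E c2E] := linear_coefs b1n b0E B1 B2.
    case: (no_root (x := r)); rewrite ?a0z ?a1z ?b0E ?c0E ?c2E; char2_ring h2.
  move=> /(eq0_mul0 (a0 ^+ 2)) A1 /(eq0_mul0 (a1 ^+ 2)) A2.
  have [c1E c3E] := constant_coefs a1z a0n A1 A2.
  rewrite c1E c3E a1z !(mul0r, mulr0) !add0r expr0n /= => B1 B2.
  (* Since [c1 = 0], the first equation for [b] reads [b1 c0 = a0^2], which is nonzero. *)
  have b1n : b1 != 0.
    apply: contraNneq a0n => b1z.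
    by move: B1; rewrite b1z mul0r => /esym/eqP; rewrite expf_eq0.
  have c0E : c0 = a0 ^+ 2 / b1 by rewrite -B1 mulrC mulKf.
  have c2E : c2 = 0 by apply: (mulfI b1n); rewrite B2 mulr0.
  exists a0^-1; first by rewrite invr_eq0.
  have s1n : a0 / b1 != 0 by rewrite mulf_neq0 ?invr_eq0.
  (* Parameters absent from the chosen form get the dummy values 0 and 1. *)
  apply: (@form_IV_intro _ _ _ 0 (b0 / a0) (a0 / b1) 1 1); rewrite ?oner_eq0 //.
  by apply: Or41; rewrite -polyC1 !cubicE; split; congr cubic;
    rewrite ?c0E ?c1E ?c2E ?c3E ?a1z; char2_field h2; rewrite ?a0n ?b1n.
move=> /(eq0_mul0 (a0 ^+ 2)) A1 /(eq0_mul0 (a1 ^+ 2)) A2.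
have [r a0E] := linear_root a0 a1n.
have [c0E c2E] := linear_coefs a1n a0E A1 A2.
(* [d] is the value of [b] at the root of [a]. It is nonzero because [c3 d = a1^2], and the
   equations then yield [c = c3 (t - r)^3]. *)
move=> B1 B2; set d := b0 + b1 * r.
have c3d : c3 * d = a1 ^+ 2.
  by rewrite -B2 c2E /d; char2_ring h2.
have c1d : c1 * d = a1 ^+ 2 * r ^+ 2.
  by rewrite -exprMn -a0E -B1 c0E /d; char2_ring h2.
have dn : d != 0.
  apply: contraNneq a1n => dz.
  by move: c3d; rewrite dz mulr0 => /esym/eqP; rewrite expf_eq0.
have c3E : c3 = a1 ^+ 2 / d by rewrite -c3d mulfK.
have c1E : c1 = a1 ^+ 2 * r ^+ 2 / d by rewrite -c1d mulfK.
have b0E : b0 = d + b1 * r by rewrite /d; char2_ring h2.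
have sn : a1 / d != 0 by rewrite mulf_neq0 ?invr_eq0.
(* With [b0] expressed through [d], the latter becomes an independent unknown for [field]. *)
clearbody d.
exists a1^-1; first by rewrite invr_eq0.
(* The case [r = 0] is split off because (IV-iii) is used with [r2 = r], which must be nonzero. *)
have [rz | rn] := eqVneq r 0.
  apply: (@form_IV_intro _ _ _ 0 (b1 / a1) (a1 / d) 1 1); rewrite ?oner_eq0 //.
  by apply: Or42; rewrite !cubicE; split; congr cubic;
    rewrite ?c0E ?c2E ?c1E ?c3E ?a0E ?b0E ?rz; char2_field h2;
    rewrite ?a1n ?dn.
have [b1z | b1n] := eqVneq b1 0.
  apply: (@form_IV_intro _ _ _ 0 0 1 (a1 / d) r); rewrite ?oner_eq0 //.
  by apply: Or43; rewrite !cubicE; split; congr cubic;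
    rewrite ?c0E ?c2E ?c1E ?c3E ?a0E ?b0E ?b1z; char2_field h2;
    rewrite ?a1n ?dn.
(* [r + d / b1 = b0 / b1] is the root of [b], that is, [t2]. *)
have rt : r + (r + d / b1) = d / b1 by char2_ring h2.
apply: (@form_IV_intro _ _ _ r (r + d / b1) 1 (a1 / d) 1); rewrite ?oner_eq0 //.
apply: Or44; rewrite rt !cubicE; split.
- by rewrite -subr_eq0 (oppr_pchar2 hk) rt mulf_neq0 ?invr_eq0.
all: by congr cubic; rewrite ?c0E ?c2E ?c1E ?c3E ?a0E ?b0E;
  char2_field h2; rewrite ?a1n ?b1n ?dn.
Qed.

(** If one of [a], [b] is linear with root [r], the equations for the other give
    [y(r) c1 = y(r) c3 = 0], where [y(r)] is its value at [r]. This value is nonzero, as [r] would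
    otherwise be a common root; so [c1 = c3 = 0], and [c0], [c2] are multiples of these. *)
Lemma relations_I :
    a0 * c1 + a1 * c0 = 0 -> a0 * c3 + a1 * c2 = 0 ->
    b0 * c1 + b1 * c0 = 0 -> b0 * c3 + b1 * c2 = 0 -> c = 0.
Proof.
move=> /(eq0_mul0 (a0 ^+ 2)) A1 /(eq0_mul0 (a1 ^+ 2)) A2.
move=> /(eq0_mul0 (b0 ^+ 2)) B1 /(eq0_mul0 (b1 ^+ 2)) B2.
have common_root (x0 x1 y0 y1 : k) : x1 != 0 ->
    x0 * c1 + x1 * c0 = 0 * x0 ^+ 2 -> x0 * c3 + x1 * c2 = 0 * x1 ^+ 2 ->
    y0 * c1 + y1 * c0 = 0 * y0 ^+ 2 -> y0 * c3 + y1 * c2 = 0 * y1 ^+ 2 ->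
    (forall x, x0 + x1 * x = 0 -> y0 + y1 * x = 0 ->
       c0 + c1 * x + c2 * x ^+ 2 + c3 * x ^+ 3 = 0 -> False) ->
    c = 0.
  move=> x1n X1 X2 Y1 Y2 no_rt; have [r x0E] := linear_root x0 x1n.
  have [c0E c2E] := linear_coefs x1n x0E X1 X2.
  have Y1' : (y0 + y1 * r) * c1 = 0.
    by rewrite -(mul0r (y0 ^+ 2)) -Y1 c0E; ring.
  have Y2' : (y0 + y1 * r) * c3 = 0.
    by rewrite -(mul0r (y1 ^+ 2)) -Y2 c2E; ring.
  have [yr0 | yrn] := eqVneq (y0 + y1 * r) 0.
    by case: (no_rt r) => //; rewrite ?x0E ?c0E ?c2E; char2_ring h2.
  have c1z : c1 = 0 by apply: (mulfI yrn); rewrite Y1' mulr0.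
  have c3z : c3 = 0 by apply: (mulfI yrn); rewrite Y2' mulr0.
  have c0z : c0 = 0 by rewrite c0E c1z; ring.
  have c2z : c2 = 0 by rewrite c2E c3z; ring.
  by rewrite c0z c1z c2z c3z cubic0.
have [a1z | a1n] := eqVneq a1 0; last first.
  exact: common_root a1n A1 A2 B1 B2 no_root.
have [b1z | b1n] := eqVneq b1 0; last first.
  by apply: common_root b1n B1 B2 A1 A2 _ => x bx ax; apply: no_root.
have [a0z | a0n] := eqVneq a0 0; last first.
  by case: top_neq0; have [_ ->] := constant_coefs a1z a0n A1 A2.
have [b0z | b0n] := eqVneq b0 0; first by case: ab_neq0.
by case: top_neq0; have [_ ->] := constant_coefs b1z b0n B1 B2.
Qed.

End Coefficients.
End Relations.

(** * Degenerate generators and the change of basis in type I *)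

Lemma generator_neq0 (k L : fieldType) (iota : {rmorphism k -> L})
    (alpha beta : L -> L) (a b c : {poly k}) :
  is_generator iota alpha beta a b c -> ~ (a = 0 /\ b = 0).
Proof.
(* The gcd is now [c], so [c] is a unit and attains no degree bound. *)
case=> cop _ top _ [a0 b0]; move: cop top; rewrite a0 b0 !gcd0p size_poly0.
by move=> /eqp_size ->; rewrite size_poly1; case.
Qed.

(** When [c = 0], a root of whichever of [a], [b] is linear would be common to all three if the
    other vanished or equalled it. *)
Lemma generator_c0 (k : closedFieldType) (L : fieldType)
    (iota : {rmorphism k -> L}) (alpha beta : L -> L) (a b : {poly k}) :
  is_generator iota alpha beta a b 0 ->
  [/\ size a = 2 \/ size b = 2, a != 0, b != 0 & a != b].
Proof.
case=> cop _ top _; have {}top : size a = 2 \/ size b = 2.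
  by case: top => [||/eqP]; [left | right | rewrite size_poly0].
have nroot x := @gcdp3_no_root k _ _ _ x cop.
have size2_root (p : {poly k}) : size p = 2 -> exists x, root p x.
  by move=> sp; apply/closed_rootP; rewrite sp.
split=> //; apply/eqP.
- move=> a0; case: top; rewrite ?a0 ?size_poly0 // => /size2_root[x bx].
  by apply: (nroot x); rewrite ?a0 ?root0.
- move=> b0; case: top; rewrite ?b0 ?size_poly0 // => /size2_root[x ax].
  by apply: (nroot x); rewrite ?b0 ?root0.
- move=> ab; case: top; rewrite ?ab => /size2_root[x bx];
  by apply: (nroot x); rewrite ?ab ?root0.
Qed.

Lemma lie_basis_transvection (k L : fieldType) (iota : {rmorphism k -> L})
    (alpha beta : L -> L) (s : k) :
  lie_basis iota alpha beta ->
  lie_basis iota (fun x => alpha x + iota s * beta x) beta.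
Proof.
case=> hal hbe free comm; split=> //.
- split=> [x y | x y | r].
  + by rewrite (derivationD hal) (derivationD hbe); ring.
  + by rewrite (derivationM hal) (derivationM hbe); ring.
  + by rewrite (derivation_const hal) (derivation_const hbe) mulr0 addr0.
- move=> r r' rr'; have [x | -> r0] := free r (r * s + r').
    by rewrite -[RHS](rr' x) rmorphD rmorphM /=; ring.
  by split=> //; rewrite -r0 mul0r add0r.
- move=> x; rewrite (derivationD hbe) (derivationM hbe).
  by rewrite (derivation_const hbe) mul0r add0r comm.
Qed.

Lemma has_typeI_transvection (k L : fieldType) (iota : {rmorphism k -> L})
    (alpha beta : L -> L) (s : k) :
  2%N \in [pchar k] -> lie_basis iota alpha beta ->
  has_type TypeI alpha beta ->
  has_type TypeI (fun x => alpha x + iota s * beta x) beta.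
Proof.
move=> hk [hal hbe _ comm] [al2 be2]; split=> // x.
have h2 : 2%:R = 0 :> L := pcharf0 (rmorph_pchar iota hk).
rewrite (derivationD hal) (derivationD hbe) (derivationM hal) (derivationM hbe).
rewrite (derivation_const hal) (derivation_const hbe) al2 be2 comm.
char2_ring h2.
Qed.

(** This is [a alpha + b beta = a (alpha + s beta) + (b - s a) beta]. *)
Lemma vfield_transvection (k L : fieldType) (iota : {rmorphism k -> L})
    (alpha beta : L -> L) (a b c : {poly k}) (s : k) :
  lie_basis iota alpha beta ->
  vfield iota alpha beta a b c =1
  vfield iota (fun x => alpha x + iota s * beta x) beta a (b - s *: a) c.
Proof.
case=> hal hbe _ _ F; have al0 := derivation0 hal; have be0 := derivation0 hbe.
have mapE : map_poly (fun x => alpha x + iota s * beta x) F =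
    map_poly alpha F + (iota s)%:P * map_poly beta F.
  apply/polyP=> i; rewrite coefD coefCM !coef_map_id0 // al0 be0.
  by rewrite mulr0 addr0.
rewrite /vfield mapE rmorphB /= map_polyZ -mul_polyC; ring.
Qed.

Lemma form_I_c0 (k : closedFieldType) (L : fieldType)
    (iota : {rmorphism k -> L}) (alpha beta : L -> L) (a b : {poly k}) :
  2%N \in [pchar k] -> lie_basis iota alpha beta ->
  has_type TypeI alpha beta -> is_generator iota alpha beta a b 0 ->
  form_I iota alpha beta a b 0.
Proof.
move=> hk hbasis htype hdelta; split=> //.
have [top _ _ _] := generator_c0 hdelta.
have [_ [sa sb _] _ _] := hdelta.
have [sa2 | sa1] := eqVneq (size a) 2; last first.
  case: top => [sa2 | sb2]; first by rewrite sa2 in sa1.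
  by left; left; split=> //; rewrite -ltnS ltn_neqAle sa1.
have [sb2 | sb1] := eqVneq (size b) 2; last first.
  by left; right; split=> //; rewrite -ltnS ltn_neqAle sb1.
have [a1n b1n] := (size_coef_neq0 sa2, size_coef_neq0 sb2).
(* This [s] cancels the leading term of [b - s a]. *)
right; split=> //; exists (b`_1 / a`_1).
  by rewrite mulf_neq0 ?invr_eq0.
split.
- exact: lie_basis_transvection.
- exact: has_typeI_transvection.
- exact: vfield_transvection.
right; split=> //; apply/leq_sizeP => -[|[|j]] // _.
  by rewrite coefB coefZ divfK // subrr.
by rewrite coefB coefZ [a`_j.+2]nth_default ?sa2 // [b`_j.+2]nth_default ?sb2 //
  mulr0 subrr.
Qed.

(** * Assembly of the four types *)

Theorem theorem5p3 (k : closedFieldType) (hk : 2%N \in [pchar k])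
    (L : fieldType) (iota : {rmorphism k -> L}) (alpha beta : L -> L)
    (ty : lie_type) (a b c : {poly k})
    (hbasis : lie_basis iota alpha beta)
    (htype : has_type ty alpha beta)
    (hdelta : is_generator iota alpha beta a b c) :
  exists2 u : k, u != 0 &
    normal_form iota alpha beta ty (u *: a) (u *: b) (u *: c).
Proof.
have [cop [sa sb sc] top _] := hdelta.
have linearE (p : {poly k}) : (size p <= 2)%N -> p = cubic p`_0 p`_1 0 0.
  move=> sp; rewrite {1}[p]cubic_coefs ?(leq_trans sp) //.
  by rewrite [p`_2]nth_default ?[p`_3]nth_default // ltnW.
have [aE bE] := (linearE a sa, linearE b sb).
have cE := cubic_coefs sc.
have no_root x : a`_0 + a`_1 * x = 0 -> b`_0 + b`_1 * x = 0 ->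
    c`_0 + c`_1 * x + c`_2 * x ^+ 2 + c`_3 * x ^+ 3 = 0 -> False.
  move=> ax bx cx; apply: (gcdp3_no_root (x := x) cop); apply/rootP.
  - by rewrite aE horner_cubic !mul0r !addr0.
  - by rewrite bE horner_cubic !mul0r !addr0.
  - by rewrite cE horner_cubic.
have ab_neq0 : ~ [/\ a`_0 = 0, a`_1 = 0, b`_0 = 0 & b`_1 = 0].
  move=> [a0 a1 b0 b1]; apply: (generator_neq0 hdelta).
  by rewrite aE bE a0 a1 b0 b1 cubic0.
have top_neq0 : ~ [/\ a`_1 = 0, b`_1 = 0 & c`_3 = 0].
  move=> [a1 b1 c3]; case: top => s.
  - by have := size_coef_neq0 s; rewrite a1 eqxx.
  - by have := size_coef_neq0 s; rewrite b1 eqxx.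
  - by have := size_coef_neq0 s; rewrite c3 eqxx.
(* Only [c != 0] allows the conclusion [g = c']; for [c = 0] the relations are used with [g]
   unknown. *)
have [c0 | cn0] := eqVneq c 0.
  have [_ an0 bn0 ab] : [/\ size a = 2 \/ size b = 2, a != 0, b != 0 & a != b].
    by apply: (@generator_c0 k L iota alpha beta); rewrite -c0.
  have relations := pclosed_relations hk hbasis _ _ hdelta.
  case: ty htype => /= -[al2 be2].
  - exists 1; first exact: oner_neq0.
    by rewrite !scale1r c0; apply: form_I_c0 => //; rewrite -c0.
  (* Here [a^2 = g a] and [b^2 = g b] would force [a = g = b]. *)
  - have [||g [ga gb _]] := relations 1 0 0 1.
    + by move=> x; rewrite al2 rmorph1 rmorph0; ring.
    + by move=> x; rewrite be2 rmorph1 rmorph0; ring.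
    move: ga gb; rewrite c0 !scale1r !scale0r !mul0r !addr0 !add0r !expr2.
    by move=> /(mulIf an0) ga /(mulIf bn0) gb; rewrite ga gb eqxx in ab.
  (* Here [a^2 = g a] gives [g = a], and [0 = g b] is impossible. *)
  - have [||g [ga gb _]] := relations 1 0 0 0.
    + by move=> x; rewrite al2 rmorph1 rmorph0; ring.
    + by move=> x; rewrite be2 rmorph0; ring.
    move: ga gb; rewrite c0 !scale1r !scale0r !mul0r !addr0 expr2.
    move=> /(mulIf an0) <- /esym/eqP.
    by rewrite mulf_eq0 (negPf an0) (negPf bn0).
  (* Here [0 = g a] gives [g = 0], and [a^2 = g b] is impossible. *)
  - have [||g [ga gb _]] := relations 0 1 0 0.
    + by move=> x; rewrite al2 rmorph1 rmorph0; ring.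
    + by move=> x; rewrite be2 rmorph0; ring.
    move: ga gb; rewrite c0 !scale1r !scale0r !mul0r !addr0.
    move=> /esym/eqP; rewrite mulf_eq0 (negPf an0) orbF => /eqP ->.
    by rewrite mul0r => /eqP; rewrite expf_eq0 (negPf an0).
have relations e11 e12 e21 e22 :
    (forall x, alpha (alpha x) = iota e11 * alpha x + iota e12 * beta x) ->
    (forall x, beta (beta x) = iota e21 * alpha x + iota e22 * beta x) ->
    [/\ a`_0 * c`_1 + a`_1 * c`_0 = e11 * a`_0 ^+ 2 + e21 * b`_0 ^+ 2,
        a`_0 * c`_3 + a`_1 * c`_2 = e11 * a`_1 ^+ 2 + e21 * b`_1 ^+ 2,
        b`_0 * c`_1 + b`_1 * c`_0 = e12 * a`_0 ^+ 2 + e22 * b`_0 ^+ 2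
      & b`_0 * c`_3 + b`_1 * c`_2 = e12 * a`_1 ^+ 2 + e22 * b`_1 ^+ 2].
  move=> al2 be2.
  have [g [ga gb gc]] := pclosed_relations hk hbasis al2 be2 hdelta.
  have [A1 A2] := relation_coefs hk sa sb cn0 gc ga.
  rewrite [e12 *: _ + _]addrC in gb.
  have [B1 B2] := relation_coefs hk sb sa cn0 gc gb.
  by split=> //; rewrite ?B1 ?B2 addrC.
rewrite aE bE cE; case: ty htype => /= -[al2 be2].
- have [||] := relations 0 0 0 0.
  + by move=> x; rewrite al2 rmorph0; ring.
  + by move=> x; rewrite be2 rmorph0; ring.
  rewrite !mul0r !addr0 => A1 A2 B1 B2; case/eqP: cn0.
  by rewrite cE; apply: relations_I A1 A2 B1 B2.
- have [||] := relations 1 0 0 1.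
  + by move=> x; rewrite al2 rmorph1 rmorph0; ring.
  + by move=> x; rewrite be2 rmorph1 rmorph0; ring.
  by rewrite !mul0r !mul1r !addr0 !add0r; apply: relations_II.
- have [||] := relations 1 0 0 0.
  + by move=> x; rewrite al2 rmorph1 rmorph0; ring.
  + by move=> x; rewrite be2 rmorph0; ring.
  by rewrite !mul0r !mul1r !addr0; apply: relations_III.
- have [||] := relations 0 1 0 0.
  + by move=> x; rewrite al2 rmorph1 rmorph0; ring.
  + by move=> x; rewrite be2 rmorph0; ring.
  by rewrite !mul0r !mul1r !addr0; apply: relations_IV.
Qed.
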